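(* For every integer $m\ge 1$, the number of edges (arcs, loops included) of the digraph $\mathcal D^*_m$ is $$|E(\mathcal D^*_m)|=\frac12\big(3^m+(-1)^m\big).$$
   Context: Digraph $\mathcal D_m$: let $\mathcal D_{ud}$ be the digraph on $\{a,b,c,d,e,f\}$ with arcs from each of $a,b,d$ to each of $b,c,f$, and from each of $c,e,f$ to each of $a,d,e$; let $\mathcal D_{lr}$ be the digraph on the same letters with arcs from each of $a,c,e$ to each of $d,e,f$, and from each of $b,d,f$ to each of $a,b,c$. $V(\mathcal D_m)$ is the set of words $\alpha_1\cdots\alpha_m$ over $\{a,b,c,d,e,f\}$ with $\alpha_1\in\{a,d,e\}$, $\alpha_m\in\{c,e,f\}$ and each $(\alpha_i,\alpha_{i+1})$, $1\le i\le m-1$, an arc of $\mathcal D_{ud}$. There is an arc $\alpha_1\cdots\alpha_m\to\beta_1\cdots\beta_m$ in $\mathcal D_m$ iff every $(\alpha_i,\beta_i)$ is an arc of $\mathcal D_{lr}$. Digraph $\mathcal D^*_m$: the outlet word of $\alpha=\alpha_1\cdots\alpha_m\in V(\mathcal D_m)$ is the binary word $o(\alpha)=o_1\cdots o_m$ with $o_j=0$ if $\alpha_j\in\{b,d,f\}$ and $o_j=1$ if $\alpha_j\in\{a,c,e\}$. Then $V(\mathcal D^*_m)=\{o(\alpha):\alpha\in V(\mathcal D_m)\}$, and there is a (single) arc $v\to w$ in $\mathcal D^*_m$ iff there are $x,y\in V(\mathcal D_m)$ with $x\to y$ in $\mathcal D_m$, $o(x)=v$, $o(y)=w$ (loops allowed).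 *)

(* Defs.v *)
From HB Require Import structures.
From mathcomp Require Import all_boot all_order all_algebra.

Set Implicit Arguments.
Unset Strict Implicit.
Unset Printing Implicit Defensive.

Inductive letter : Type := La | Lb | Lc | Ld | Le | Lf.

Definition nat_of_letter (x : letter) : nat :=
  match x with La => 0 | Lb => 1 | Lc => 2 | Ld => 3 | Le => 4 | Lf => 5 end.

Definition letter_of_nat (n : nat) : letter := nth Lf [:: La; Lb; Lc; Ld; Le] n.

Lemma nat_of_letterK : cancel nat_of_letter letter_of_nat.
Proof. by case. Qed.

HB.instance Definition _ := Countable.copy letter (can_type nat_of_letterK).

Lemma letter_enumP : Finite.axiom [:: La; Lb; Lc; Ld; Le; Lf].
Proof. by case. Qed.

HB.instance Definition _ := isFinite.Build letter letter_enumP.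

Definition D_ud : rel letter := fun x y =>
  (x \in [:: La; Lb; Ld]) && (y \in [:: Lb; Lc; Lf])
  || (x \in [:: Lc; Le; Lf]) && (y \in [:: La; Ld; Le]).

Definition D_lr : rel letter := fun x y =>
  (x \in [:: La; Lc; Le]) && (y \in [:: Ld; Le; Lf])
  || (x \in [:: Lb; Ld; Lf]) && (y \in [:: La; Lb; Lc]).

(* Positions are numbered from 0, so the first letter has index 0 and the
   last one has index m - 1. *)
Definition VD (m : nat) : {set m.-tuple letter} :=
  [set w : m.-tuple letter |
    [&& [forall i : 'I_m,
           (i == 0 :> nat) ==> (tnth w i \in [:: La; Ld; Le])],
        [forall i : 'I_m,
           (i.+1 == m) ==> (tnth w i \in [:: Lc; Le; Lf])]
      & [forall i : 'I_m, forall j : 'I_m,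
           (j == i.+1 :> nat) ==> D_ud (tnth w i) (tnth w j)]]].

Definition ED (m : nat) : {set m.-tuple letter * m.-tuple letter} :=
  [set p : m.-tuple letter * m.-tuple letter |
    [&& p.1 \in VD m, p.2 \in VD m
      & [forall i : 'I_m, D_lr (tnth p.1 i) (tnth p.2 i)]]].

(* The binary digit 1 is [true] and 0 is [false]. *)
Definition outlet (x : letter) : bool := x \in [:: La; Lc; Le].

Definition outlet_word (m : nat) (w : m.-tuple letter) : m.-tuple bool :=
  [tuple of map outlet w].

Definition VDstar (m : nat) : {set m.-tuple bool} :=
  [set outlet_word w | w in VD m].

Definition EDstar (m : nat) : {set m.-tuple bool * m.-tuple bool} :=
  [set p : m.-tuple bool * m.-tuple bool |
    [&& p.1 \in VDstar m, p.2 \in VDstar m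
      & [exists x : m.-tuple letter, exists y : m.-tuple letter,
           [&& (x, y) \in ED m, outlet_word x == p.1 & outlet_word y == p.2]]]].

(* Main.v *)
Require Import Defs.
From mathcomp Require Import all_boot all_order all_algebra.
From mathcomp Require Import ring.

Import GRing.Theory.
Local Open Scope ring_scope.

(** Read a letter as a cell that is joined to exactly two of its four
    neighbours: [D_ud] matches the lower side of a cell with the upper side of
    the next one, [D_lr] matches the right side ([outlet]) of a cell with the
    left side ([inlet] below) of the cell beside it.

    If an arc [v -> w] of the digraph of outlet words is witnessed by [x -> y],
    then [v] is the inlet word of the column [y] and [w] its outlet word.
    Conversely, every column [y] yields the arc from its inlet word to its outlet
    word: reflecting [y] left to right gives a column whose outlet word is the
    inlet word of [y] ([EDstar_imset]). A column is recovered from its two words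
    from top to bottom: three sides of a cell determine it, and the upper side
    is known from the cell above ([column_inj]). So there are as many arcs as
    columns.

    Columns are walks for [D_ud], whose adjacency matrix depends only on the
    lower side of the source. From either kind of lower side, one letter keeps
    the kind and two letters switch it, a two-state transfer matrix with
    eigenvalues 3 and -1; this gives the count ([card_columns_from]). *)

(** The cell [Le] is joined to neither of its vertical neighbours, so it can
    stand for the horizontal border on both ends; the two boundary conditions
    of [VD] then become ordinary steps of the walk. *)
Lemma VD_path (m : nat) (w : m.-tuple letter) :
  (w \in VD m) = path D_ud Le (rcons w Le).
Proof.
have up0 y : D_ud Le y = (y \in [:: La; Ld; Le]) by case: y.
have down0 y : D_ud y Le = (y \in [:: Lc; Le; Lf]) by case: y.
(* With [Le] as default value, [nth] also reads the border below the word. *)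
have pathE : path D_ud Le (rcons w Le) <->
    (forall i, (i <= m)%N -> D_ud (nth Le (Le :: w) i) (nth Le w i)).
  split=> [/(pathP Le) + i le_im|steps].
    move/(_ i); rewrite size_rcons size_tuple ltnS => /(_ le_im).
    by rewrite -rcons_cons !nth_rcons_default.
  apply/(pathP Le) => i; rewrite size_rcons size_tuple ltnS => /steps.
  by rewrite -rcons_cons !nth_rcons_default.
rewrite inE; apply/idP/idP => [/and3P[/forallP top /forallP bot /forallP mid]|].
  apply/pathE => -[_|i lt_im] /=.
    case: (posnP m) => [m0|m_gt0]; first by rewrite nth_default // size_tuple m0.
    rewrite up0 -(tnth_nth Le w (Ordinal m_gt0)).
    exact: (implyP (top (Ordinal m_gt0))).
  rewrite -(tnth_nth Le w (Ordinal lt_im)).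
  have [lt_i1m|ge_i1m] := ltnP i.+1 m.
    rewrite -(tnth_nth Le w (Ordinal lt_i1m)).
    exact: (implyP (forallP (mid (Ordinal lt_im)) (Ordinal lt_i1m))).
  rewrite nth_default ?size_tuple // down0.
  by apply: (implyP (bot _)); rewrite /= eqn_leq lt_im.
move/pathE => step; apply/and3P; split; apply/forallP => i.
- apply/implyP => /eqP i0; rewrite -up0 (tnth_nth Le) i0.
  exact: (step 0%N).
- apply/implyP => /eqP im; have := step i.+1 (ltn_ord i).
  by rewrite /= [X in D_ud _ X]nth_default ?size_tuple ?im // down0 (tnth_nth Le).
- apply/forallP => j; apply/implyP => /eqP ji.
  by have := step i.+1 (ltn_ord i); rewrite !(tnth_nth Le) ji.
Qed.

Definition inlet (x : letter) : bool := x \in [:: Ld; Le; Lf].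

Definition inlet_word {m : nat} (w : m.-tuple letter) : m.-tuple bool :=
  [tuple of map inlet w].

Lemma D_lrE (x y : letter) : D_lr x y = (outlet x == inlet y).
Proof. by case: x; case: y. Qed.

Lemma D_lr_words (m : nat) (x y : m.-tuple letter) :
  [forall i : 'I_m, D_lr (tnth x i) (tnth y i)]
  = (outlet_word x == inlet_word y).
Proof.
apply/forallP/eqP => [xy|xy i].
  by apply: eq_from_tnth => i; rewrite !tnth_map; apply/eqP; rewrite -D_lrE.
by rewrite D_lrE; have := congr1 (fun u => tnth u i) xy; rewrite !tnth_map => ->.
Qed.

(** Left-right reflection of a cell. *)
Definition mirror (x : letter) : letter :=
  match x with La => Ld | Ld => La | Lc => Lf | Lf => Lc | _ => x end.

Lemma mirror_VD (m : nat) (w : m.-tuple letter) :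
  w \in VD m -> [tuple of map mirror w] \in VD m.
Proof.
rewrite !VD_path /= -(map_rcons mirror w Le) -[X in _ -> path _ X _]/(mirror Le).
by apply: homo_path => x y; case: x; case: y.
Qed.

Lemma outlet_mirror (m : nat) (w : m.-tuple letter) :
  outlet_word [tuple of map mirror w] = inlet_word w.
Proof.
by apply: val_inj; rewrite /= -map_comp; apply: eq_map; case.
Qed.

(** The witness of the arc given by [y] is the reflected column, which ends
    where [y] begins. *)
Lemma EDstar_imset (m : nat) :
  EDstar m = [set (inlet_word y, outlet_word y) | y in VD m].
Proof.
apply/setP => -[v w]; rewrite inE /=.
apply/and3P/imsetP => [[_ _ /existsP[x /existsP[y]]]|[y yV [-> ->]]].
  rewrite inE /= D_lr_words => /and3P[/and3P[_ yV /eqP xy] /eqP <- /eqP <-].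
  by exists y; rewrite ?xy.
have xV := mirror_VD _ _ yV; split.
- by apply/imsetP; exists [tuple of map mirror y]; rewrite ?outlet_mirror.
- exact: imset_f.
apply/existsP; exists [tuple of map mirror y]; apply/existsP; exists y.
by rewrite inE /= D_lr_words xV yV outlet_mirror !eqxx.
Qed.

(** Two of the four sides of a cell are joined, so three sides decide the
    fourth, and distinct letters join distinct pairs of sides. *)
Lemma letter_det (x y z : letter) :
  D_ud x y -> D_ud x z -> inlet y = inlet z -> outlet y = outlet z -> y = z.
Proof. by case: x; case: y => //; case: z. Qed.

Lemma column_inj (x : letter) (s t : seq letter) :
  path D_ud x (rcons s Le) -> path D_ud x (rcons t Le) ->
  map inlet s = map inlet t -> map outlet s = map outlet t -> s = t.
Proof.
elim: s x t => [|y s IHs] x [|z t] //= /andP[xy ys] /andP[xz zt].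
move=> [in_yz in_st] [out_yz out_st].
have eq_yz := letter_det _ _ _ xy xz in_yz out_yz; rewrite -eq_yz in zt *.
by rewrite (IHs y t).
Qed.

Lemma card_EDstar (m : nat) : #|EDstar m| = #|VD m|.
Proof.
rewrite EDstar_imset card_in_imset // => s t.
rewrite !VD_path => s_path t_path [in_st out_st].
exact/val_inj/(column_inj _ _ _ s_path t_path).
Qed.

Definition columns_from (m : nat) (x : letter) : {set m.-tuple letter} :=
  [set w : m.-tuple letter | path D_ud x (rcons w Le)].

Lemma card_columns_fromS (m : nat) (x : letter) :
  #|columns_from m.+1 x| = (\sum_(y | D_ud x y) #|columns_from m y|)%N.
Proof.
under eq_bigr do rewrite -sum1_card.
rewrite pair_big_dep -sum1_card /=.
rewrite (reindex (fun p : letter * m.-tuple letter => [tuple of p.1 :: p.2])) /=.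
  by apply: eq_bigl => -[y w]; rewrite !inE.
exists (fun w => (thead w, [tuple of behead w])) => [[y w] _|w _].
  by congr (_, _); apply: val_inj.
by rewrite [RHS]tuple_eta.
Qed.

(** The empty word closes a walk from [x] exactly when [D_ud x Le], so the
    count starts from the vector (1, 0), half the sum of the eigenvector (1, 1)
    for 3 and the eigenvector (1, -1) for -1; the sign below is the coordinate
    of the latter at [x]. *)
Lemma card_columns_from (m : nat) (x : letter) :
  (#|columns_from m x|)%:R
  = 1 / 2 * (3 ^+ m + (-1) ^+ (~~ D_ud x Le) * (-1) ^+ m) :> rat.
Proof.
elim: m x => [|m IHm] x.
  have -> : columns_from 0 x = if D_ud x Le then [set [tuple]] else set0.
    by apply/setP => w; rewrite tuple0 inE /= andbT; case: ifP; rewrite !inE.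
  by case: (D_ud x Le); rewrite ?cards1 ?cards0.
rewrite card_columns_fromS natr_sum.
under eq_bigr do rewrite IHm.
have letters : enum {: letter} = [:: La; Lb; Lc; Ld; Le; Lf] by rewrite enumT unlock.
rewrite big_mkcond -big_enum letters !big_cons big_nil /=.
by case: x; rewrite /= !exprS !expr0; field.
Qed.

Theorem theorem3p11 (m : nat) (hm : (1 <= m)%N) :
  (#|EDstar m|)%:R = 1 / 2 * (3 ^+ m + (-1) ^+ m) :> rat.
Proof.
have VDE : VD m = columns_from m Le by apply/setP => w; rewrite VD_path inE.
by rewrite card_EDstar VDE card_columns_from [X in _ + X]mul1r.
Qed.
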